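(* Let $G=(V,E)$ be an $L$-graph with associated semiflow $\Phi_G$ on $\mathcal{P}(V)$. The recurrent set $\mathcal{R}$ of $\Phi_G$ satisfies $$\mathcal{R}=\bigcap\{A\cup A^{\ast}:\ A \text{ is an attractor}\},$$ and the Morse sets of the finest Morse decomposition of $\Phi_G$ coincide with the $\Phi_G$-connected components of $\mathcal{R}$.
   Context: A graph $G=(V,E)$ is a finite directed graph without multiple edges, $E\subset V\times V$; it is an $L$-graph if every vertex has at least one outgoing edge. A path of length $n\ge 0$ is a sequence of vertices $\langle i_0\ldots i_n\rangle$ with $(i_p,i_{p+1})\in E$ for $0\le p<n$. The semiflow of $G$ is $\Phi_G:\mathbb{N}\times\mathcal{P}(V)\to\mathcal{P}(V)$ ($\mathbb{N}=\{0,1,\dots\}$), where $\Phi_G(n,A)$ is the set of $j\in V$ for which there is a path of length $n$ from some $i\in A$ to $j$. The $\omega$-limit set is $\omega(A)=\{y\in V:\text{ there are } t_k\to\infty \text{ with } y\in\Phi_G(t_k,A)\}$. A one-point set $\{i\}$ is recurrent if there is a sequence $n_l\to\infty$ with $i\in\Phi_G(n_l,\{i\})$; the recurrent set is $\mathcal{R}=\{i\in V:\{i\}\text{ is recurrent}\}$. A set $A\in\mathcal{P}(V)$ is an attractor if there is $N\subset V$ with $A\subset N$ and $\omega(N)=A$ (the empty set is allowed as an attractor); its complementary repeller is $A^\ast=\{i\in V:\omega(\{i\})\setminus A\neq\varnothing\}$. A set $B\subset V$ is connected under $\Phi_G$ if for any $i,j\in B$ there are $n\in\mathbb{N}$ and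 a map $p:\{0,\dots,n\}\to B$ with $p(0)=i$, $p(n)=j$ and $p(m+1)\in\Phi_G(1,\{p(m)\})$ for $m=0,\dots,n-1$; the $\Phi_G$-connected components of $\mathcal{R}$ are its maximal (with respect to inclusion) nonempty connected subsets. A set $A$ is weakly invariant if $\Phi_G(n,A)\cap A\ne\varnothing$ for all $n\in\mathbb{N}$. A finite collection $\mathcal{A}\subset\mathcal{P}(V)$ satisfies the no-cycle condition if for any $l\ge1$ and any members $A_{j_0},\dots,A_{j_l}$ of $\mathcal{A}$, not all equal, with $\omega(A_{j_\alpha})\cap A_{j_{\alpha+1}}\ne\varnothing$ for $\alpha=0,\dots,l-1$, one has $A_{j_0}\neq A_{j_l}$. A Morse decomposition of $\Phi_G$ is a finite collection of nonempty, pairwise disjoint, weakly invariant sets (called Morse sets) whose union contains $\mathcal{R}$ and which satisfies the no-cycle condition. A Morse decomposition $\mathcal{M}$ is finer than $\mathcal{M}'$ if every element of $\mathcal{M}$ is contained in some element of $\mathcal{M}'$; the finest Morse decomposition is the one finer than every Morse decomposition (it exists and is unique for an $L$-graph). *)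

(* Defs.v *)
From mathcomp Require Import boolp classical_sets filter.
From mathcomp Require Import all_boot.

Set Implicit Arguments.
Unset Strict Implicit.
Unset Printing Implicit Defensive.

(* A graph on the finite vertex set V is its edge relation E : rel V, so there
   are no multiple edges and loops are allowed. *)
Definition L_graph (V : finType) (E : rel V) : Prop :=
  forall i, exists j, E i j.

(* The path <i_0 ... i_n> is represented by i_0 and the n-tuple of the
   vertices that follow it. *)
Definition semiflow (V : finType) (E : rel V) (n : nat) (A : {set V}) :
    {set V} :=
  [set j | [exists i in A, exists p : n.-tuple V,
              path E i p && (last i p == j)]].

Definition tends_to_infinity (t : nat -> nat) : Prop :=
  (t @ \oo --> \oo)%classic.

Definition omega_limit (V : finType) (E : rel V) (A : {set V}) : {set V} :=
  [set y | `[< exists t : nat -> nat, tends_to_infinity t /\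
                 forall k, y \in semiflow E (t k) A >]].

Definition recurrent (V : finType) (E : rel V) (i : V) : Prop :=
  exists t : nat -> nat, tends_to_infinity t /\
    forall l, i \in semiflow E (t l) [set i].

Definition recurrent_set (V : finType) (E : rel V) : {set V} :=
  [set i | `[< recurrent E i >]].

Definition attractor (V : finType) (E : rel V) (A : {set V}) : bool :=
  [exists N : {set V}, (A \subset N) && (omega_limit E N == A)].

Definition complementary_repeller (V : finType) (E : rel V) (A : {set V}) :
    {set V} :=
  [set i | omega_limit E [set i] :\: A != set0].

(* For m : 'I_n, widen_ord (leqnSn n) m and lift ord0 m are the elements m and
   m + 1 of 'I_n.+1. *)
Definition flow_connected (V : finType) (E : rel V) (B : {set V}) : Prop :=
  forall i j, i \in B -> j \in B ->
  exists (n : nat) (p : 'I_n.+1 -> V),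
    [/\ forall m, p m \in B,
        p ord0 = i,
        p ord_max = j
      & forall m : 'I_n,
          p (lift ord0 m) \in semiflow E 1 [set p (widen_ord (leqnSn n) m)]].

Definition connected_component (V : finType) (E : rel V) (S B : {set V}) :
    bool :=
  maxset (fun C => [&& C != set0, C \subset S & `[< flow_connected E C >]]) B.

Definition weakly_invariant (V : finType) (E : rel V) (A : {set V}) : Prop :=
  forall n, semiflow E n A :&: A != set0.

Definition no_cycle (V : finType) (E : rel V) (M : {set {set V}}) : Prop :=
  forall (l : nat) (A : 'I_l.+1 -> {set V}),
    1 <= l ->
    (forall a, A a \in M) ->
    ~ (forall a b, A a = A b) ->
    (forall a : 'I_l,
       omega_limit E (A (widen_ord (leqnSn l) a)) :&: A (lift ord0 a)
         != set0) ->
    A ord0 <> A ord_max.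

Record Morse_decomposition (V : finType) (E : rel V) (M : {set {set V}}) :
    Prop := {
  Morse_nonempty : forall A, A \in M -> A != set0;
  Morse_disjoint : trivIset M;
  Morse_weakly_invariant : forall A, A \in M -> weakly_invariant E A;
  Morse_recurrent : recurrent_set E \subset cover M;
  Morse_no_cycle : no_cycle E M
}.

Definition finer (V : finType) (M M' : {set {set V}}) : Prop :=
  forall A, A \in M -> exists2 B, B \in M' & A \subset B.

Definition finest_Morse_decomposition (V : finType) (E : rel V)
    (M : {set {set V}}) : Prop :=
  Morse_decomposition E M /\
  forall M', Morse_decomposition E M' -> finer M M'.

(* Main.v *)
Require Import Defs.
From mathcomp Require Import boolp classical_sets filter.
From mathcomp Require Import all_boot.

Set Implicit Arguments.
Unset Strict Implicit.
Unset Printing Implicit Defensive.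

(** A vertex is recurrent iff it lies on a closed path of positive length, and,
    by the pigeonhole principle, omega(A) is the set of vertices reachable from
    a recurrent vertex that is itself reachable from A.  Hence, for i not
    recurrent, omega({i}) is an attractor such that i belongs neither to it nor
    to its complementary repeller.  The connected components of the recurrent
    set are the strong components of the recurrent vertices; they form a Morse
    decomposition, and two Morse sets A <> B meeting the same strong component
    would give the forbidden cycle A, B, A. *)

(** Trades divergent sequences of times for arbitrarily large times. Conversely, choosing for each
    [N] a time at least [N] yields a divergent sequence, which need not be monotone. *)
Lemma tends_to_infinityP (P : nat -> Prop) :
  (exists t, tends_to_infinity t /\ forall k, P (t k)) <->
  (forall N, exists2 n, N <= n & P n).
Proof.
split=> [[t [t_oo tP]] N|Pinf].
  have [|k _ kN] := t_oo [set n | N <= n]%classic; first by exists N.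
  by exists (t k); [apply: (kN k) => /=|].
(* The [let] repackages [exists2] as [ex] of a conjunction, the shape that [choice] takes. *)
have [t tP] := choice (fun N => (let: ex_intro2 n a b := Pinf N in
  ex_intro (fun n => N <= n /\ P n) n (conj a b))).
exists t; split=> [A [N _ NA]|k]; last by have [] := tP k.
exists N => // k /= Nk; apply: NA => /=.
by apply: leq_trans Nk _; have [] := tP k.
Qed.

(** * Paths, recurrence and omega-limit sets *)

Section Semiflow.
Variables (V : finType) (E : rel V).
Implicit Types (i j x y : V) (A B C : {set V}).

Lemma semiflowP n A j :
  reflect (exists2 i, i \in A & exists p, [/\ size p = n, path E i p & last i p = j])
          (j \in semiflow E n A).
Proof.
rewrite inE; apply: (iffP exists_inP) => -[i iA].
  case/existsP=> p /andP[ip /eqP pj]; exists i => //.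
  by exists p; rewrite size_tuple.
case=> p [/eqP pn ip pj]; exists i => //; apply/existsP.
by exists (Tuple pn); rewrite /= ip pj eqxx.
Qed.

Lemma semiflow_trans m n A i j :
  i \in semiflow E m A -> j \in semiflow E n [set i] ->
  j \in semiflow E (m + n) A.
Proof.
case/semiflowP=> a aA [p [<- ap pi]] /semiflowP[_ /set1P-> [q [<- iq qj]]].
apply/semiflowP; exists a => //; exists (p ++ q).
by rewrite size_cat cat_path last_cat pi ap iq.
Qed.

Lemma mem_semiflow1 i j : (j \in semiflow E 1 [set i]) = E i j.
Proof.
apply/semiflowP/idP => [[_ /set1P-> [[|x [|y p]] [//= _]]]|ij].
  by rewrite andbT => ix <-.
by exists i; rewrite ?set11 //; exists [:: j]; rewrite /= ij.
Qed.

Lemma connect_semiflowP i j :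
  reflect (exists n, j \in semiflow E n [set i]) (connect E i j).
Proof.
apply: (iffP connectP) => [[p ip ->]|[n]].
  by exists (size p); apply/semiflowP; exists i; rewrite ?set11 //; exists p.
by case/semiflowP=> _ /set1P-> [p [_ ip pj]]; exists p.
Qed.

Lemma recurrent_unbounded i :
  recurrent E i <-> forall m, exists2 n, m <= n & i \in semiflow E n [set i].
Proof. exact: (tends_to_infinityP (fun n => i \in semiflow E n [set i])). Qed.

Lemma omega_limit_unbounded A y :
  y \in omega_limit E A <-> forall m, exists2 n, m <= n & y \in semiflow E n A.
Proof.
rewrite -(tends_to_infinityP (fun n => y \in semiflow E n A)) inE.
by split=> /asboolP.
Qed.

(** Going round the closed path [N] times takes time [N * n], which is at least [N] because [n] is
    positive. *)
Lemma closed_path_recurrent i n :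
  0 < n -> i \in semiflow E n [set i] -> recurrent E i.
Proof.
move=> n_gt0 ii; apply/recurrent_unbounded => N.
exists (N * n); first by rewrite leq_pmulr.
elim: N => [|N IHN]; last by rewrite mulSn; apply: semiflow_trans ii IHN.
by apply/semiflowP; exists i; rewrite ?set11 //; exists [::].
Qed.

(** As [connect] is reflexive, an initial edge is split off to force the closed path to have
    positive length. *)
Lemma recurrentP i : recurrent E i <-> exists2 j, E i j & connect E j i.
Proof.
split=> [|[j ij /connect_semiflowP[n ji]]]; last first.
  apply: (@closed_path_recurrent i (1 + n)) => //.
  by apply: semiflow_trans ji; rewrite mem_semiflow1.
case/recurrent_unbounded/(_ 1)=> n n_gt0.
case/semiflowP=> _ /set1P-> [[|j p] [pn]]; first by rewrite -pn in n_gt0.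
by case/andP=> ij jp pi; exists j => //; apply/connectP; exists p.
Qed.

Lemma mem_recurrent_set i : i \in recurrent_set E <-> recurrent E i.
Proof. by rewrite inE; split=> /asboolP. Qed.

(** Either the first vertex occurs again and so lies on a closed path, or the repetition is in the
    tail and induction applies. *)
Lemma nonuniq_path_recurrent x p :
  path E x p -> ~~ uniq (x :: p) ->
  exists r, [/\ recurrent E r, connect E x r & connect E r (last x p)].
Proof.
elim: p x => [|y p IHp] x //= /andP[xy yp]; rewrite negb_and negbK.
case/orP=> [x_yp|/(IHp _ yp)[r [rr yr r_last]]]; last first.
  by exists r; split=> //; apply: connect_trans yr; apply: connect1.
have y_last: connect E y (last y p) by apply/connectP; exists p.
exists x; split=> //; last by apply: connect_trans y_last; apply: connect1.
by apply/recurrentP; exists y => //; apply: path_connect x_yp.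
Qed.

Lemma omega_limitP A y :
  y \in omega_limit E A <->
  exists a r, [/\ a \in A, recurrent E r, connect E a r & connect E r y].
Proof.
split=> [|[a [r [aA rr ar ry]]]].
  (* A path of length at least [#|V|] lists more than [#|V|] vertices, its start included, so one of
     them repeats. *)
  case/omega_limit_unbounded/(_ #|V|) => n Vn.
  case/semiflowP=> a aA [p [pn ap <-]].
  have [|r [rr ar ry]] := nonuniq_path_recurrent ap.
    by apply/negP => /card_uniqP ap_uniq; have := max_card (mem (a :: p));
       rewrite ap_uniq /= pn ltnNge Vn.
  by exists a, r.
apply/omega_limit_unbounded => N.
case/recurrent_unbounded/(_ N): rr => n Nn rr.
have [m /semiflowP[_ /set1P-> ar']] := connect_semiflowP _ _ ar.
have [l ry'] := connect_semiflowP _ _ ry.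
(* Go from [a] to [r], return to [r] after a time [n] at least [N], then go on to [y]. *)
exists (m + n + l); first by rewrite -addnA addnCA (leq_trans Nn) ?leq_addr.
apply: semiflow_trans ry'; apply: semiflow_trans rr.
by apply/semiflowP; exists a.
Qed.

(** A recurrent [r] with [i] leading to [r] and back is either [i] itself, or the first edge towards
    [r] starts a closed path through [i]. *)
Lemma mem_omega_limit1 i :
  (i \in omega_limit E [set i]) <-> recurrent E i.
Proof.
split=> [|ri]; last by apply/omega_limitP; exists i, i; rewrite set11.
case/omega_limitP=> _ [r [/set1P-> rr ir ri]].
have [ -> // |neq_ir] := eqVneq i r.
case/connectP: ir => -[|j p] /=; first by move=> _ ri'; rewrite ri' eqxx in neq_ir.
case/andP=> ij jp r_last; apply/recurrentP; exists j => //.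
by apply: connect_trans ri; apply/connectP; exists p.
Qed.

(** This lets an omega-limit set serve as its own neighbourhood [N] in the definition of
    [attractor]. *)
Lemma omega_limit_idem A : omega_limit E (omega_limit E A) = omega_limit E A.
Proof.
apply/setP=> y; apply/idP/idP => /omega_limitP.
  case=> x [r [/omega_limitP[a [s [aA rs as_ sx]] rr xr ry]]].
  apply/omega_limitP; exists a, s; split=> //.
  exact: connect_trans (connect_trans sx xr) ry.
case=> a [r [aA rr ar ry]]; apply/omega_limitP; exists r, r; split=> //.
by apply/omega_limitP; exists a, r.
Qed.

(** * Attractors and the recurrent set *)

Lemma attractor_omega_limit A : attractor E (omega_limit E A).
Proof.
by apply/existsP; exists (omega_limit E A); rewrite subxx omega_limit_idem eqxx.
Qed.

Lemma recurrent_set_attractors :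
  recurrent_set E =
    \bigcap_(A : {set V} | attractor E A) (A :|: complementary_repeller E A).
Proof.
apply/setP=> i; apply/idP/bigcapP => [/mem_recurrent_set ri A _|iAA].
  (* A recurrent [i] outside [A] belongs to its own omega-limit set, hence to the complementary
     repeller. *)
  rewrite !inE -implyNb; apply/implyP => iA; apply/set0Pn; exists i.
  by rewrite in_setD iA; apply/mem_omega_limit1.
have := iAA _ (attractor_omega_limit [set i]).
rewrite in_setU [X in _ || X]inE setDv eqxx orbF.
by move/mem_omega_limit1/mem_recurrent_set.
Qed.

(** * Strong components and flow-connected sets *)

Definition strong_component i := [set j | connect E i j && connect E j i].

Lemma strong_component_id i : i \in strong_component i.
Proof. by rewrite inE connect0. Qed.

Lemma strong_component_connect i x y :
  x \in strong_component i -> y \in strong_component i -> connect E x y.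
Proof.
by rewrite !inE => /andP[_ xi] /andP[iy _]; apply: connect_trans xi iy.
Qed.

Lemma eq_strong_component i j :
  connect E i j -> connect E j i -> strong_component i = strong_component j.
Proof.
move=> ij ji; apply/setP=> x; rewrite !inE.
by apply/andP/andP=> -[ix xi]; split;
   by [apply: connect_trans ix|apply: connect_trans xi _].
Qed.

Lemma strong_component_recurrent i x :
  recurrent E i -> x \in strong_component i -> recurrent E x.
Proof.
rewrite inE => ri /andP[ix xi]; apply/mem_omega_limit1/omega_limitP.
by exists x, i; rewrite set11.
Qed.

Lemma strong_component_flow_connected i : flow_connected E (strong_component i).
Proof.
move=> x y xi yi; have /connectP[p xp ylast] := strong_component_connect xi yi.
(* The path must stay inside the component: a vertex between [x] and [y] is reachable from [i]
   through [x] and leads back to [i] through [y]. *)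
have pxy z : z \in x :: p -> z \in strong_component i.
  move=> zp; have xz := path_connect xp zp.
  have zy: connect E z y.
    rewrite ylast; case/splitPl: p / zp xp {ylast xz} => p1 p2 p1z.
    by rewrite cat_path last_cat p1z => /andP[_ zp2]; apply/connectP; exists p2.
  move: xi yi; rewrite !inE => /andP[ix _] /andP[_ yi].
  by rewrite (connect_trans ix xz) (connect_trans zy yi).
exists (size p), (fun m => nth x (x :: p) m); split=> // [m||m].
- by apply/pxy/mem_nth/ltn_ord.
- by rewrite ylast (last_nth x).
- by rewrite mem_semiflow1; apply: (pathP x xp _ (ltn_ord m)).
Qed.

Lemma flow_connected_connect B x y :
  flow_connected E B -> x \in B -> y \in B -> connect E x y.
Proof.
move=> cB xB yB; have [n [p [_ <- <- pE]]] := cB x y xB yB.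
(* Indexing by a natural number with its bound makes induction along [p] possible; ordinals are then
   matched by [val_inj]. *)
suff p0 m (ltmn : m < n.+1) : connect E (p ord0) (p (Ordinal ltmn)).
  by rewrite (_ : ord_max = Ordinal (ltnSn n)) //; apply: val_inj.
elim: m ltmn => [|m IHm] ltmn; first by rewrite (_ : Ordinal _ = ord0) //; apply: val_inj.
apply: connect_trans (IHm (ltnW ltmn)) (connect1 _).
have := pE (Ordinal (ltmn : m < n)); rewrite mem_semiflow1.
by congr (is_true (E (p _) (p _))); apply: val_inj.
Qed.

(** Any flow-connected set containing [i] lies in [strong_component i], which for recurrent [i] is
    itself a candidate; so these are exactly the maximal candidates. *)
Lemma connected_componentP C :
  connected_component E (recurrent_set E) C <->
  exists2 i, recurrent E i & C = strong_component i.
Proof.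
have sub_strong B i : flow_connected E B -> i \in B -> B \subset strong_component i.
  by move=> cB iB; apply/subsetP=> x xB; rewrite inE !(flow_connected_connect cB).
have strongP i : recurrent E i ->
    [&& strong_component i != set0, strong_component i \subset recurrent_set E
      & `[< flow_connected E (strong_component i) >]].
  move=> ri; apply/and3P; split.
  - by apply/set0Pn; exists i; apply: strong_component_id.
  - by apply/subsetP=> x /(strong_component_recurrent ri)/mem_recurrent_set.
  - exact/asboolP/strong_component_flow_connected.
split=> [/maxsetP[/and3P[/set0Pn[i iC] /subsetP/(_ i iC) ri /asboolP cC] Cmax]|[i ri ->]].
  move/mem_recurrent_set: ri => ri; exists i => //.
  by rewrite (Cmax _ (strongP i ri)) // sub_strong.
apply/maxsetP; split=> [|B /and3P[_ _ /asboolP cB] iB]; first exact: strongP.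
apply/eqP; rewrite eqEsubset iB andbT.
by apply: sub_strong => //; apply/(subsetP iB)/strong_component_id.
Qed.

(** * The components as the finest Morse decomposition *)

Let components := [set C | connected_component E (recurrent_set E) C].

Lemma componentsP C :
  C \in components <-> exists2 i, recurrent E i & C = strong_component i.
Proof. by rewrite inE; apply: connected_componentP. Qed.

(** Each vertex of the component is recurrent, so it has an edge along a closed path, which ends in
    the component again; iterate. *)
Lemma strong_component_weakly_invariant i :
  recurrent E i -> weakly_invariant E (strong_component i).
Proof.
move=> ri; elim=> [|n /set0Pn[x /setIP[nx xi]]]; apply/set0Pn.
  exists i; rewrite inE strong_component_id andbT.
  by apply/semiflowP; exists i; [apply: strong_component_id|exists [::]].
have /recurrentP[y xy yx] := strong_component_recurrent ri xi.
exists y; rewrite inE -addn1 (semiflow_trans nx) ?mem_semiflow1 //=.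
move: xi; rewrite !inE => /andP[ix xi].
by rewrite (connect_trans ix (connect1 xy)) (connect_trans yx xi).
Qed.

(** If the chain closes up, all its members reach one another, so they are one and the same strong
    component. *)
Lemma components_no_cycle : no_cycle E components.
Proof.
move=> l A _ AM nconst AE A0l; apply: nconst.
have step (a : 'I_l) x y : x \in A (widen_ord (leqnSn l) a) -> y \in A (lift ord0 a) ->
    connect E x y.
  move=> xA yA; have /set0Pn[z /setIP[/omega_limitP[w [r [wA _ wr rz]]] zA]] := AE a.
  have /componentsP[i _ iE] := AM (widen_ord (leqnSn l) a).
  have /componentsP[j _ jE] := AM (lift ord0 a).
  rewrite iE in xA wA; rewrite jE in yA zA.
  apply: connect_trans (strong_component_connect zA yA).
  exact: connect_trans (connect_trans (strong_component_connect xA wA) wr) rz.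
have connA a x y : x \in A a -> y \in A a -> connect E x y.
  by have /componentsP[i _ ->] := AM a; apply: strong_component_connect.
have neA a : exists x, x \in A a.
  have /componentsP[i _ ->] := AM a.
  by exists i; apply: strong_component_id.
(* Induction on [b], chaining [step] through an arbitrary vertex of each intermediate set. *)
have incr (a b : 'I_l.+1) x y :
    a <= b -> x \in A a -> y \in A b -> connect E x y.
  case: b => m ltm /=; elim: m ltm y => [|m IHm] ltm y.
    rewrite leqn0 => /eqP a0 xA yA; apply: connA xA _.
    by rewrite (_ : a = Ordinal ltm) //; apply/val_inj.
  rewrite leq_eqVlt => /orP[/eqP am|am] xA yA.
    by apply: connA xA _; rewrite (_ : a = Ordinal ltm) //; apply/val_inj.
  have [z zA] := neA (Ordinal (ltnW ltm)).
  apply: connect_trans (IHm (ltnW ltm) z am xA zA) _.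
  apply: (step (Ordinal (ltm : m < l))).
    by rewrite (_ : widen_ord _ _ = Ordinal (ltnW ltm)) //; apply/val_inj.
  by rewrite (_ : lift _ _ = Ordinal ltm) //; apply/val_inj.
have all_conn a b x y : x \in A a -> y \in A b -> connect E x y.
  have [z zA] := neA ord0 => xA yA.
  (* Climb from [A a] to the last set, which equals the first by [A0l], then climb from there to
     [A b]. *)
  apply: (@connect_trans _ _ z); last exact: incr zA yA.
  by apply: (@incr a ord_max); rewrite -?A0l // -ltnS.
move=> a b; have /componentsP[i _ iE] := AM a; have /componentsP[j _ jE] := AM b.
rewrite iE jE; apply: eq_strong_component.
  by apply: (all_conn a b); rewrite ?iE ?jE strong_component_id.
by apply: (all_conn b a); rewrite ?iE ?jE strong_component_id.
Qed.

Lemma components_Morse_decomposition : Morse_decomposition E components.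
Proof.
split.
- move=> _ /componentsP[i _ ->]; apply/set0Pn; exists i.
  exact: strong_component_id.
- apply/trivIsetP=> _ _ /componentsP[i _ ->] /componentsP[j _ ->].
  apply: contraR => /pred0Pn[x /andP[/= xi xj]]; apply/eqP.
  have := (strong_component_connect xi (strong_component_id i),
           strong_component_connect xj (strong_component_id j),
           strong_component_connect (strong_component_id i) xi,
           strong_component_connect (strong_component_id j) xj).
  case=> [[[xi' xj'] ix] jx].
  by apply: eq_strong_component; apply: connect_trans; eassumption.
- by move=> _ /componentsP[i ri ->]; apply: strong_component_weakly_invariant.
- apply/subsetP=> i /mem_recurrent_set ri; apply/bigcupP.
  exists (strong_component i); last exact: strong_component_id.
  by apply/componentsP; exists i.
- exact: components_no_cycle.
Qed.

Lemma no_cycle2 (M : {set {set V}}) A B :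
  no_cycle E M -> A \in M -> B \in M ->
  omega_limit E A :&: B != set0 -> omega_limit E B :&: A != set0 -> A = B.
Proof.
move=> nc AM BM AB BA; have [// | neqAB] := eqVneq A B.
(* The family takes the values A, B, A at 0, 1, 2, so its two ends agree, against [nc]. *)
case: (nc 2 (fun a : 'I_3 => if a == 1 :> nat then B else A)) => //.
- by move=> a; case: ifP.
- by move/(_ ord0 (Ordinal (isT : 1 < 3))) => /= eqAB; rewrite eqAB eqxx in neqAB.
- by case=> -[|[|//]].
Qed.

Lemma components_finer M : Morse_decomposition E M -> finer components M.
Proof.
move=> MM _ /componentsP[i ri ->].
have coverP x : recurrent E x -> exists2 A, A \in M & x \in A.
  by move/mem_recurrent_set/(subsetP (Morse_recurrent MM))/bigcupP=> -[A]; exists A.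
have [A AM iA] := coverP i ri; exists A => //; apply/subsetP=> x xi.
have rx := strong_component_recurrent ri xi.
have [B BM xB] := coverP x rx; move: xi; rewrite inE => /andP[ix xi].
(* The recurrent [i] in [A] leads to [x] in [B], and the recurrent [x] leads back to [i]; this gives
   both required intersections. *)
rewrite (no_cycle2 (Morse_no_cycle MM) AM BM) //; apply/set0Pn.
  by exists x; rewrite inE xB andbT; apply/omega_limitP; exists i, i.
by exists i; rewrite inE iA andbT; apply/omega_limitP; exists x, x.
Qed.

(** A set of [M] lies in some [B] of [M'], which lies in some [C] of [M]. Disjointness and
    nonemptiness force the outer two to coincide, and [B] with them. Applied in both directions,
    this gives uniqueness of the finest decomposition. *)
Lemma finer_antisym_sub (M M' : {set {set V}}) :
  (forall A, A \in M -> A != set0) -> trivIset M ->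
  finer M M' -> finer M' M -> M \subset M'.
Proof.
move=> ne disj MM' M'M; apply/subsetP=> A AM.
have [B BM' AB] := MM' A AM; have [C CM BC] := M'M B BM'.
have [x xA] := set0Pn _ (ne A AM).
have eqAC: A = C.
  apply/eqP/negP => /negP/(trivIsetP disj _ _ AM CM)/disjointFr/(_ xA).
  by rewrite (subsetP (subset_trans AB BC)).
by rewrite (_ : A = B) //; apply/eqP; rewrite eqEsubset AB eqAC.
Qed.

Lemma finest_Morse_decompositionE M :
  finest_Morse_decomposition E M <-> M = components.
Proof.
have MC := components_Morse_decomposition.
split=> [[MM Mfin]|->]; last by split=> // M'; apply: components_finer.
have [MfC CfM] := conj (Mfin _ MC) (components_finer MM).
apply/eqP; rewrite eqEsubset !finer_antisym_sub //.
- exact: Morse_nonempty MC.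
- exact: Morse_disjoint MC.
- exact: Morse_nonempty MM.
- exact: Morse_disjoint MM.
Qed.

End Semiflow.

Theorem theorem3p22 (V : finType) (E : rel V) (hE : L_graph E) :
  recurrent_set E =
    \bigcap_(A : {set V} | attractor E A) (A :|: complementary_repeller E A)
  /\ forall M : {set {set V}},
       finest_Morse_decomposition E M <->
       M = [set C : {set V} | connected_component E (recurrent_set E) C].
Proof.
split; first exact: recurrent_set_attractors.
exact: finest_Morse_decompositionE.
Qed.
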